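(* For classifiers $f\in\mathcal F$, the three disparity measures $$\mathrm{DD}(f)=\mathbb P(\widehat Y_f=1\mid A=1)-\mathbb P(\widehat Y_f=1\mid A=0),$$ $$\mathrm{DO}(f)=\mathbb P(\widehat Y_f=1\mid A=1,Y=1)-\mathbb P(\widehat Y_f=1\mid A=0,Y=1),$$ $$\mathrm{PD}(f)=\mathbb P(\widehat Y_f=1\mid A=1,Y=0)-\mathbb P(\widehat Y_f=1\mid A=0,Y=0)$$ are bilinear disparity measures, with weighting functions given for all $x\in\mathcal X$, $a\in\{0,1\}$ by $$w_{\mathrm{DD}}(x,a)=\frac{2a-1}{p_a},\qquad w_{\mathrm{DO}}(x,a)=\frac{(2a-1)\eta_a(x)}{p_{a,1}},\qquad w_{\mathrm{PD}}(x,a)=\frac{(2a-1)(1-\eta_a(x))}{p_{a,0}}.$$ In particular $s_{\mathrm{DD},a}=0$ and $b_{\mathrm{DD},a}=(2a-1)/p_a$ for $a\in\{0,1\}$, and the coefficients $s_{\cdot,a},b_{\cdot,a}$ for $\mathrm{DO}$ and $\mathrm{PD}$ are those read off from the displayed weighting functions.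
   Context: Let $(X,A,Y)\sim\mathbb P$ be a random triple with values in $\mathcal X\times\{0,1\}\times\{0,1\}$ ($X$ features, $A$ protected attribute, $Y$ label). Write $p_a=\mathbb P(A=a)$, $p_{a,y}=\mathbb P(A=a,Y=y)$ (nonzero), and $\eta_a(x)=\mathbb P(Y=1\mid A=a,X=x)$. $\mathbb P_{X,A}$ denotes the joint law of $(X,A)$. A (randomized) classifier is a measurable $f:\mathcal X\times\{0,1\}\to[0,1]$; $\mathcal F$ is the set of all of them. Its prediction $\widehat Y_f\in\{0,1\}$ satisfies $\widehat Y_f\mid X=x,A=a\sim\mathrm{Bernoulli}(f(x,a))$, and is conditionally independent of $Y$ given $(X,A)$. A disparity measure $\mathrm{Dis}:\mathcal F\to[-1,1]$ is linear if for all $\mathbb P$ there is a weighting function $w_{\mathrm{Dis}}:\mathcal X\times\{0,1\}\to\mathbb R$ (depending on $\mathbb P$) such that for all $f\in\mathcal F$, $\mathrm{Dis}(f)=\int f(x,a)\,w_{\mathrm{Dis}}(x,a)\,d\mathbb P_{X,A}(x,a)$. A linear disparity measure is bilinear if moreover there are real numbers $s_{\mathrm{Dis},a},b_{\mathrm{Dis},a}$, depending only on $a$ (and $\mathbb P$), with $w_{\mathrm{Dis}}(x,a)=s_{\mathrm{Dis},a}\,\eta_a(x)+b_{\mathrm{Dis},a}$ for all $x,a$. *)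

(* Defs.v *)
From HB Require Import structures.
From mathcomp Require Import all_boot all_order all_algebra.
From mathcomp Require Import all_classical all_reals all_analysis.

Set Implicit Arguments.
Unset Strict Implicit.
Unset Printing Implicit Defensive.
Import Order.TTheory GRing.Theory Num.Theory.
Import numFieldNormedType.Exports.
Local Open Scope classical_set_scope.
Local Open Scope ring_scope.

(* The values 0, 1 of A, Y and the prediction are the booleans false, true. *)

Section elementary_probability.
Context {R : realType} {d d1 d2 : measure_display}.
Context {Omega : measurableType d} {T1 : measurableType d1}
        {T2 : measurableType d2}.

Definition cond_pr (mu : probability Omega R) (E F : set Omega) : R :=
  fine (mu (E `&` F)) / fine (mu F).

Definition pair_RV (U : {mfun Omega >-> T1}) (V : {mfun Omega >-> T2})
    (o : Omega) : T1 * T2 :=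
  (U o, V o).

Section pair_RV_measurable.
Variables (U : {mfun Omega >-> T1}) (V : {mfun Omega >-> T2}).

Let measurable_pair_RV : measurable_fun [set: Omega] (pair_RV U V).
Proof. by apply: measurable_fun_pair. Qed.

HB.instance Definition _ :=
  isMeasurableFun.Build _ _ _ _ (pair_RV U V) measurable_pair_RV.
End pair_RV_measurable.

(* g is a version of z |-> P(E | Z = z). *)
Definition is_cond_prob (mu : probability Omega R) (E : set Omega)
    (Z : {RV mu >-> T1}) (g : T1 -> R) : Prop :=
  (distribution mu Z).-integrable [set: T1] (EFin \o g) /\
  forall B : set T1, measurable B ->
    mu (E `&` Z @^-1` B) = (\int[distribution mu Z]_(z in B) (g z)%:E)%E.

End elementary_probability.

Arguments is_cond_prob {R d d1 Omega T1} mu E Z g.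

(* Conditional independence of two {0,1}-valued variables U, V given Z:
   P(U = u, V = v | Z) = P(U = u | Z) P(V = v | Z) a.s.; the conditional
   probabilities on the right exist and are unique up to a.s. equality, so
   ranging over all their versions is the same as fixing one. *)
Definition cond_indep {R : realType} {d d1 : measure_display}
    {Omega : measurableType d} {T1 : measurableType d1}
    (mu : probability Omega R) (U V : {RV mu >-> bool}) (Z : {RV mu >-> T1}) :
    Prop :=
  forall (u v : bool) (gU gV : T1 -> R),
    is_cond_prob mu (U @^-1` [set u]) Z gU ->
    is_cond_prob mu (V @^-1` [set v]) Z gV ->
    is_cond_prob mu (U @^-1` [set u] `&` V @^-1` [set v]) Z
      (fun z => gU z * gV z).

Arguments cond_indep {R d d1 Omega T1} mu U V Z.

Section fair_classification.
Context {R : realType} {d : measure_display}.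
Variable X : measurableType d.

Record law := Law {
  law_prob :> probability (X * bool * bool)%type R ;
  law_neq0 : forall a y : bool,
    law_prob [set z | z.1.2 = a /\ z.2 = y] != 0%E }.

Definition prA (P : law) (a : bool) : R := fine (P [set z | z.1.2 = a]).

Definition prAY (P : law) (a y : bool) : R :=
  fine (P [set z | z.1.2 = a /\ z.2 = y]).

Definition proj_XA (z : X * bool * bool) : X * bool := z.1.

Let measurable_proj_XA : measurable_fun [set: X * bool * bool] proj_XA.
Proof. exact: measurable_fst. Qed.

HB.instance Definition _ :=
  isMeasurableFun.Build _ _ _ _ proj_XA measurable_proj_XA.

Definition law_XA (P : law) : probability (X * bool)%type R :=
  distribution P proj_XA.

(* eta a x is a version of P(Y = 1 | A = a, X = x). *)
Definition is_regression (P : law) (eta : bool -> X -> R) : Prop :=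
  is_cond_prob P [set z | z.2 = true] proj_XA
    (fun xa => eta xa.2 xa.1).

Record classifier := Classifier {
  clf_fun :> {mfun (X * bool)%type >-> R} ;
  clf_ge0_le1 : forall xa, 0 <= clf_fun xa <= 1 }.

(* A probability space carrying (X, A, Y) ~ P together with the randomized
   prediction of f. *)
Record prediction (P : law) (f : classifier) := Prediction {
  pd_disp : measure_display ;
  pd_space : measurableType pd_disp ;
  pd_prob : probability pd_space R ;
  pd_X : {RV pd_prob >-> X} ;
  pd_A : {RV pd_prob >-> bool} ;
  pd_Y : {RV pd_prob >-> bool} ;
  pd_Yhat : {RV pd_prob >-> bool} ;
  pd_law : forall B : set (X * bool * bool), measurable B ->
    distribution pd_prob (pair_RV (pair_RV pd_X pd_A) pd_Y) B = P B ;
  pd_bernoulli : forall yh : bool,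
    is_cond_prob pd_prob (pd_Yhat @^-1` [set yh]) (pair_RV pd_X pd_A)
      (fun xa => bernoulli_pmf (f xa) yh) ;
  pd_indep : cond_indep pd_prob pd_Yhat pd_Y (pair_RV pd_X pd_A) }.

Section disparities.
Variable pred : forall (P : law) (f : classifier), prediction P f.

Definition DD (P : law) (f : classifier) : R :=
  let M := pred P f in
  cond_pr (pd_prob M) [set o | pd_Yhat M o = true]
                      [set o | pd_A M o = true]
  - cond_pr (pd_prob M) [set o | pd_Yhat M o = true]
                        [set o | pd_A M o = false].

Definition DO (P : law) (f : classifier) : R :=
  let M := pred P f in
  cond_pr (pd_prob M) [set o | pd_Yhat M o = true]
                      [set o | pd_A M o = true /\ pd_Y M o = true]
  - cond_pr (pd_prob M) [set o | pd_Yhat M o = true]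
                        [set o | pd_A M o = false /\ pd_Y M o = true].

Definition PD (P : law) (f : classifier) : R :=
  let M := pred P f in
  cond_pr (pd_prob M) [set o | pd_Yhat M o = true]
                      [set o | pd_A M o = true /\ pd_Y M o = false]
  - cond_pr (pd_prob M) [set o | pd_Yhat M o = true]
                        [set o | pd_A M o = false /\ pd_Y M o = false].

End disparities.

Definition disparity_measure (Dis : law -> classifier -> R) : Prop :=
  forall P f, -1 <= Dis P f <= 1.

(* Integrability of w makes every integral below a genuine one; it is forced
   by the case where f is constantly 1. *)
Definition is_weighting (P : law) (DisP : classifier -> R)
    (w : X -> bool -> R) : Prop :=
  (law_XA P).-integrable [set: X * bool] (fun xa => (w xa.1 xa.2)%:E) /\
  forall f : classifier,
    (DisP f)%:E = (\int[law_XA P]_xa (f xa * w xa.1 xa.2)%:E)%E.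

Definition linear_disparity (Dis : law -> classifier -> R) : Prop :=
  disparity_measure Dis /\
  forall P, exists w : X -> bool -> R, is_weighting P (Dis P) w.

Definition has_coefficients (eta : bool -> X -> R) (w : X -> bool -> R)
    (s b : bool -> R) : Prop :=
  forall x a, w x a = s a * eta a x + b a.

Definition bilinear_disparity (eta : law -> bool -> X -> R)
    (Dis : law -> classifier -> R) : Prop :=
  linear_disparity Dis /\
  forall P, exists w : X -> bool -> R, is_weighting P (Dis P) w /\
    exists s b : bool -> R, has_coefficients (eta P) w s b.

Definition sgnA (a : bool) : R := 2 * (a : nat)%:R - 1.

Definition wDD (P : law) (x : X) (a : bool) : R := sgnA a / prA P a.

Definition wDO (P : law) (eta : bool -> X -> R) (x : X) (a : bool) : R :=
  sgnA a * eta a x / prAY P a true.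

Definition wPD (P : law) (eta : bool -> X -> R) (x : X) (a : bool) : R :=
  sgnA a * (1 - eta a x) / prAY P a false.

End fair_classification.

Arguments law : clear implicits.
Arguments classifier : clear implicits.
Arguments sgnA : clear implicits.

(* Main.v *)
Require Import Defs.
From HB Require Import structures.
From mathcomp Require Import all_boot all_order all_algebra.
From mathcomp Require Import all_classical all_reals all_analysis.
From mathcomp Require Import lra.

Set Implicit Arguments.
Unset Strict Implicit.
Unset Printing Implicit Defensive.
Import Order.TTheory GRing.Theory Num.Theory.
Import numFieldNormedType.Exports.
Local Open Scope classical_set_scope.
Local Open Scope ring_scope.

(** All expectations live on the law of (X, A).  Conditional independence makes
    f(x, a) P(Y = y | X = x, A = a) a version of P(Yhat = 1, Y = y | X, A);
    integrating it over the slice {A = a} and dividing by p_{a,y} gives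
    P(Yhat = 1 | A = a, Y = y).  The difference of the two slices is one
    integral over (X, A), the sign 2a - 1 marking the slice. *)

(** * Signs and conditional probabilities of events *)

Lemma sgnA_true {R : realType} : sgnA R true = 1.
Proof. by rewrite /sgnA mulr1; lra. Qed.

Lemma sgnA_false {R : realType} : sgnA R false = -1.
Proof. by rewrite /sgnA mulr0 sub0r. Qed.

Lemma cond_pr_ge0_le1 {R : realType} {d : measure_display}
    {T : measurableType d} (mu : probability T R) (E F : set T) :
  measurable E -> measurable F -> 0 <= cond_pr mu E F <= 1.
Proof.
move=> mE mF; have mEF := measurableI _ _ mE mF.
have F0 : 0 <= fine (mu F) by rewrite fine_ge0.
have EF0 : 0 <= fine (mu (E `&` F)) by rewrite fine_ge0.
rewrite /cond_pr divr_ge0//=.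
(* Division by zero returns 0, so a null [F] is no exception to the bounds. *)
have [->|Fn0] := eqVneq (fine (mu F)) 0; first by rewrite invr0 mulr0.
rewrite ler_pdivrMr ?lt_neqAle 1?eq_sym ?Fn0// mul1r.
by rewrite fine_le ?fin_num_measure// le_measure ?inE.
Qed.

(** Integrating [1 - g] over [B] gives the mass of the preimage of [B] minus the mass of its part
    inside [E]. This turns the regression function, which describes [Y = 1], into a version for
    [Y = 0]. *)
Lemma is_cond_probC {R : realType} {d d1 : measure_display}
    {Omega : measurableType d} {T1 : measurableType d1}
    (mu : probability Omega R) (E : set Omega) (Z : {RV mu >-> T1})
    (g : T1 -> R) :
  measurable E -> is_cond_prob mu E Z g ->
  is_cond_prob mu (~` E) Z (fun z => 1 - g z).
Proof.
move=> mE [ig gE]; have i1 : (distribution mu Z).-integrable setT (EFin \o cst 1).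
  exact: finite_measure_integrable_cst.
split; first exact: (integrableB measurableT i1 ig).
move=> B mB; have mZB : measurable (Z @^-1` B).
  by rewrite -[_ @^-1` _]setTI; exact: measurable_funPT.
rewrite (_ : (fun z => (1 - g z)%:E) = fun z => ((cst 1 z)%:E - (g z)%:E)%E)//.
rewrite (integralB_EFin mB); last 2 first.
- exact: (integrableS measurableT).
- exact: (integrableS measurableT).
rewrite -gE// (_ : (\int[_]_(x in B) _)%E = mu (Z @^-1` B)); last first.
  exact: etrans (integral_cst _ mB 1%E) (mul1e _).
(* The left side is the mass of a set difference; finiteness of [mu] allows the subtraction. *)
rewrite [in LHS]setIC -setDE measureD//.
  by rewrite setIC.
by rewrite ltey_eq fin_num_measure.
Qed.

(** * From the space of the prediction to the law of (X, A) *)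

Section prediction.
Context {R : realType} {d : measure_display} {X : measurableType d}.
Variables (P : law R d X) (f : classifier R d X) (M : prediction P f).

Notation mu := (pd_prob M).
Notation XA := (pair_RV (pd_X M) (pd_A M)).

(** The law of the triple is prescribed by [pd_law]; its value on the cylinder over [B] is the
    marginal on (X, A). *)
Lemma distribution_XA (B : set (X * bool)) : measurable B ->
  distribution mu XA B = law_XA P B.
Proof.
move=> mB; have mBT : measurable (B `*` [set: bool]) by exact: measurableX.
have := pd_law M mBT; rewrite /law_XA /distribution /pushforward.
have -> : B `*` [set: bool] = @proj_XA d X @^-1` B by apply/seteqP; split=> z //= [].
by [].
Qed.

(** The regression function is given on the space of [P], while [cond_indep] asks for versions on
    the space of the prediction. The transfer works because being a version of P(Y = 1 | X, A)
    involves only the law of the triple. *)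
Lemma is_cond_prob_Y (eta : bool -> X -> R) : is_regression P eta ->
  is_cond_prob mu (pd_Y M @^-1` [set true]) XA (fun xa => eta xa.2 xa.1).
Proof.
move=> [ig gE]; split.
  have /integrableP[mg fg] := ig; apply/integrableP; split => //.
  rewrite (eq_measure_integral (law_XA P))// => A mA _.
  exact: distribution_XA.
move=> B mB; rewrite (eq_measure_integral (law_XA P)); last first.
  by move=> A mA _; exact: distribution_XA.
rewrite -gE//; have mBY : measurable (B `*` [set true]) by exact: measurableX.
have -> : [set z : X * bool * bool | z.2 = true] `&` @proj_XA d X @^-1` B =
    B `*` [set true] by apply/seteqP; split=> -[z b] /= [].
rewrite -(pd_law M mBY); congr (mu _).
by apply/seteqP; split=> o /= [].
Qed.

Lemma is_cond_prob_NY (eta : bool -> X -> R) : is_regression P eta ->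
  is_cond_prob mu (pd_Y M @^-1` [set false]) XA
    (fun xa => 1 - eta xa.2 xa.1).
Proof.
move=> etaP; have mY : measurable (pd_Y M @^-1` [set true]).
  by rewrite -[_ @^-1` _]setTI; exact: measurable_funPT.
have -> : pd_Y M @^-1` [set false] = ~` (pd_Y M @^-1` [set true]).
  by apply/seteqP; split=> o /=; case: (pd_Y M o).
exact: (is_cond_probC mY (is_cond_prob_Y etaP)).
Qed.

(** This is the defining identity of [is_cond_prob] at the slice of points with second coordinate
    [a], with the integral moved to [law_XA P]. *)
Lemma fine_cond_prob (E : set (pd_space M)) (g : X * bool -> R) (a : bool) :
  is_cond_prob mu E XA g ->
  fine (mu (E `&` [set o | pd_A M o = a])) =
  \int[law_XA P]_(xa in [set xa | xa.2 = a]) g xa.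
Proof.
move=> [_ gE]; have ma : measurable [set xa : X * bool | xa.2 = a].
  rewrite (_ : [set _ | _] = snd @^-1` [set a])// -[_ @^-1` _]setTI.
  exact: measurable_snd.
rewrite /Rintegral -(eq_measure_integral (law_XA P) (m1 := distribution mu XA)).
  by rewrite -gE.
by move=> A mA _; exact: distribution_XA.
Qed.

Lemma prA_prediction (a : bool) :
  fine (mu [set o | pd_A M o = a]) = prA P a.
Proof.
rewrite /prA -(pd_law M)//.
rewrite (_ : [set _ | _] = (setT `*` [set a]) `*` setT).
  by apply: measurableX => //; exact: measurableX.
by apply/seteqP; split=> -[[x b] y] //= [[]].
Qed.

Lemma prAY_prediction (a y : bool) :
  fine (mu [set o | pd_A M o = a /\ pd_Y M o = y]) = prAY P a y.
Proof.
rewrite /prAY -(pd_law M)//.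
rewrite (_ : [set _ | _] = (setT `*` [set a]) `*` [set y]).
  by apply: measurableX => //; exact: measurableX.
by apply/seteqP; split=> -[[x b] z] //= [] // [].
Qed.

Lemma cond_pr_A (a : bool) :
  cond_pr mu [set o | pd_Yhat M o = true] [set o | pd_A M o = a] =
  (\int[law_XA P]_(xa in [set xa | xa.2 = a]) f xa) / prA P a.
Proof.
(* By computation [bernoulli_pmf (f xa) true] is [f xa], so [f] itself is integrated over the
   slice. *)
by rewrite /cond_pr prA_prediction (fine_cond_prob _ (pd_bernoulli M true)).
Qed.

(** By conditional independence [f * h] is a version for the joint event that the prediction is 1
    and [Y = y]; its integral over the slice is the numerator. Leaving [h] free covers both [eta]
    and [1 - eta]. *)
Lemma cond_pr_AY (a y : bool) (h : X * bool -> R) :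
  is_cond_prob mu (pd_Y M @^-1` [set y]) XA h ->
  cond_pr mu [set o | pd_Yhat M o = true]
             [set o | pd_A M o = a /\ pd_Y M o = y] =
  (\int[law_XA P]_(xa in [set xa | xa.2 = a]) (f xa * h xa)) / prAY P a y.
Proof.
move=> hY; rewrite /cond_pr prAY_prediction; congr (_ / _).
rewrite -(fine_cond_prob _ (pd_indep (pd_bernoulli M true) hY)).
congr (fine (mu _)); apply/seteqP; split=> o /=; tauto.
Qed.

Lemma measurable_Yhat : measurable [set o | pd_Yhat M o = true].
Proof.
rewrite (_ : [set _ | _] = pd_Yhat M @^-1` [set true])// -[_ @^-1` _]setTI.
exact: measurable_funPT.
Qed.

Lemma measurable_A (a : bool) : measurable [set o | pd_A M o = a].
Proof.
rewrite (_ : [set _ | _] = pd_A M @^-1` [set a])// -[_ @^-1` _]setTI.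
exact: measurable_funPT.
Qed.

Lemma measurable_AY (a y : bool) :
  measurable [set o | pd_A M o = a /\ pd_Y M o = y].
Proof.
rewrite (_ : [set _ | _] = [set o | pd_A M o = a] `&` (pd_Y M @^-1` [set y]))//.
apply: measurableI; first exact: measurable_A.
by rewrite -[_ @^-1` _]setTI; exact: measurable_funPT.
Qed.

End prediction.

(** * Weighting functions and bilinearity *)

Lemma ler_distB1 {R : realDomainType} (p q : R) :
  0 <= p <= 1 -> 0 <= q <= 1 -> -1 <= p - q <= 1.
Proof. by move=> /andP[p0 p1] /andP[q0 q1]; apply/andP; split; lra. Qed.

(** One computation serves all three measures: [h] will be 1, [eta] or [1 - eta], and [c] the
    matching probability. The factor [sgnA R a / c a] is constant on each slice, so it passes
    through the integral there, and the two slices partition the space. *)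
Lemma is_weighting_split {R : realType} {d : measure_display}
    {X : measurableType d} (P : law R d X) (D : classifier R d X -> R)
    (h : X * bool -> R) (c : bool -> R) :
  (law_XA P).-integrable setT (EFin \o h) ->
  (forall f : classifier R d X, D f =
    (\int[law_XA P]_(xa in [set xa | xa.2 = true]) (f xa * h xa)) / c true -
    (\int[law_XA P]_(xa in [set xa | xa.2 = false]) (f xa * h xa)) / c false) ->
  is_weighting P D (fun x a => sgnA R a * h (x, a) / c a).
Proof.
move=> ih DE; pose k (a : bool) : R := sgnA R a / c a.
have wE xa : sgnA R xa.2 * h (xa.1, xa.2) / c xa.2 = k xa.2 * h xa.
  by rewrite -surjective_pairing mulrAC.
have mk : measurable_fun [set: X * bool] (fun xa => k xa.2).
  by apply: (measurableT_comp (f := k)).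
(* Only two values occur, so multiplication by [k] preserves the integrability of [h]. *)
have bk : [bounded k xa.2 | xa in [set: X * bool]].
  exists (Num.max `|k true| `|k false|); split; first exact: num_real.
  move=> x kx [y a] _ /=; apply/ltW/(le_lt_trans _ kx).
  by rewrite le_max; case: a; rewrite lexx ?orbT.
have iw : (law_XA P).-integrable setT (fun xa => (k xa.2 * h xa)%:E).
  exact: (integrableMr measurableT mk bk ih).
split.
  by rewrite (_ : (fun xa => _) = fun xa => (k xa.2 * h xa)%:E)//;
    apply/funext => xa; rewrite wE.
(* Since [f] takes values in [0, 1], products with it stay integrable. *)
move=> f; have bf : [bounded f xa | xa in [set: X * bool]].
  exists 1; split; first exact: num_real.
  move=> x x1 xa _ /=; have /andP[f0 f1] := clf_ge0_le1 f xa.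
  by rewrite ger0_norm// (le_trans f1)// ltW.
have ifh : (law_XA P).-integrable setT (EFin \o (fun xa => f xa * h xa)).
  exact: (integrableMr measurableT (measurable_funPT f) bf ih).
have ifw : (law_XA P).-integrable setT
    (EFin \o (fun xa => f xa * (k xa.2 * h xa))).
  exact: (integrableMr measurableT (measurable_funPT f) bf iw).
have ma a : measurable [set xa : X * bool | xa.2 = a].
  rewrite (_ : [set _ | _] = snd @^-1` [set a])// -[_ @^-1` _]setTI.
  exact: measurable_snd.
have slice a : \int[law_XA P]_(xa in [set xa | xa.2 = a])
    (f xa * (k xa.2 * h xa)) =
    k a * \int[law_XA P]_(xa in [set xa | xa.2 = a]) (f xa * h xa).
  rewrite -RintegralZl//; last exact: (integrableS measurableT).
  by apply: eq_Rintegral => xa; rewrite inE /= => ->; rewrite mulrCA.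
have TE : [set: X * bool] =
    [set xa | xa.2 = true] `|` [set xa | xa.2 = false].
  by apply/seteqP; split=> -[x []] //= _; [left|right].
(* Splitting and scaling are done on real-valued integrals; integrability then gives the return to
   extended reals. *)
transitivity (\int[law_XA P]_xa (f xa * (k xa.2 * h xa)))%:E.
  rewrite {1}TE Rintegral_setU//.
  (* The slices carry the signs 1 and -1, which reproduces the difference in [DE]. *)
  - rewrite !slice DE /k sgnA_true sgnA_false mul1r mulN1r mulNr.
    by rewrite [_ / c true]mulrC [_ / c false]mulrC.
  - by rewrite -TE.
  - by apply/disj_setPS => -[x a] /= [->].
rewrite /Rintegral fineK; last exact: integrable_fin_num.
by apply: eq_integral => xa _; rewrite wE.
Qed.

Lemma bilinear_disparityP {R : realType} {d : measure_display}
    {X : measurableType d} (eta : law R d X -> bool -> X -> R)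
    (Dis : law R d X -> classifier R d X -> R)
    (w : law R d X -> X -> bool -> R) (s b : law R d X -> bool -> R) :
  disparity_measure Dis ->
  (forall P, is_weighting P (Dis P) (w P)) ->
  (forall P, has_coefficients (eta P) (w P) (s P) (b P)) ->
  bilinear_disparity eta Dis.
Proof.
move=> D1 Dw ws; split; first by split=> // P; exists (w P).
by move=> P; exists (w P); split=> //; exists (s P), (b P).
Qed.

Theorem proposition3p4 (R : realType) (d : measure_display)
    (X : measurableType d)
    (eta : law R d X -> bool -> X -> R)
    (eta_regression : forall P : law R d X, is_regression P (eta P))
    (pred : forall (P : law R d X) (f : classifier R d X), prediction P f) :
  [/\ bilinear_disparity eta (DD pred),
      bilinear_disparity eta (DO pred) &
      bilinear_disparity eta (PD pred)] /\
  forall P : law R d X,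
    [/\ is_weighting P (DD pred P) (wDD P),
        is_weighting P (DO pred P) (wDO P (eta P)) &
        is_weighting P (PD pred P) (wPD P (eta P))] /\
    [/\ has_coefficients (eta P) (wDD P)
          (fun=> 0) (fun a => sgnA R a / prA P a),
        has_coefficients (eta P) (wDO P (eta P))
          (fun a => sgnA R a / prAY P a true) (fun=> 0) &
        has_coefficients (eta P) (wPD P (eta P))
          (fun a => - (sgnA R a / prAY P a false))
          (fun a => sgnA R a / prAY P a false)].
Proof.
have DD1 : disparity_measure (DD pred).
  move=> P f; apply: ler_distB1; apply: cond_pr_ge0_le1;
    by [exact: measurable_Yhat | exact: measurable_A].
have DO1 : disparity_measure (DO pred).
  move=> P f; apply: ler_distB1; apply: cond_pr_ge0_le1;
    by [exact: measurable_Yhat | exact: measurable_AY].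
have PD1 : disparity_measure (PD pred).
  move=> P f; apply: ler_distB1; apply: cond_pr_ge0_le1;
    by [exact: measurable_Yhat | exact: measurable_AY].
have ieta P : (law_XA P).-integrable setT
    (EFin \o fun xa => eta P xa.2 xa.1) by exact: (eta_regression P).1.
have i1 (P : law R d X) : (law_XA P).-integrable setT (EFin \o cst 1).
  exact: finite_measure_integrable_cst.
have DDw P : is_weighting P (DD pred P) (wDD P).
  rewrite (_ : wDD P = fun x a => sgnA R a * cst 1 (x, a) / prA P a); last first.
    by apply/funext => x; apply/funext => a; rewrite /wDD mulr1.
  apply: is_weighting_split => // f; rewrite /DD !cond_pr_A.
  by congr (_ / _ - _ / _); apply: eq_Rintegral => xa _; rewrite mulr1.
have DOw P : is_weighting P (DO pred P) (wDO P (eta P)).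
  apply: (@is_weighting_split _ _ _ P _ (fun xa => eta P xa.2 xa.1)) => // f.
  by rewrite /DO !(cond_pr_AY _ (is_cond_prob_Y _ (eta_regression P))).
(* For [Y = 0] the version is the complement [1 - eta], integrable as a difference of integrable
   functions. *)
have PDw P : is_weighting P (PD pred P) (wPD P (eta P)).
  apply: (@is_weighting_split _ _ _ P _ (fun xa => 1 - eta P xa.2 xa.1)) => [|f].
    exact: (integrableB measurableT (i1 P) (ieta P)).
  by rewrite /PD !(cond_pr_AY _ (is_cond_prob_NY _ (eta_regression P))).
have DDc P : has_coefficients (eta P) (wDD P)
    (fun=> 0) (fun a => sgnA R a / prA P a).
  by move=> x a; rewrite mul0r add0r.
have DOc P : has_coefficients (eta P) (wDO P (eta P))
    (fun a => sgnA R a / prAY P a true) (fun=> 0).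
  by move=> x a; rewrite addr0 /wDO mulrAC.
(* Expanding [1 - eta] makes the slope the opposite of the intercept. *)
have PDc P : has_coefficients (eta P) (wPD P (eta P))
    (fun a => - (sgnA R a / prAY P a false)) (fun a => sgnA R a / prAY P a false).
  by move=> x a; rewrite /wPD mulrAC mulrBr mulr1 addrC mulNr.
split=> [|P]; last by split.
split.
- exact: (bilinear_disparityP (s := fun=> fun=> 0) DD1 DDw DDc).
- exact: (bilinear_disparityP (b := fun=> fun=> 0) DO1 DOw DOc).
- exact: (bilinear_disparityP PD1 PDw PDc).
Qed.
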